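(* Let $(X,\rho)$ be a complete metric space and let $\mathcal{K}\subset C(\mathbb{R}^+,X)$ satisfy (K1)–(K4) (listed in the context), with associated strict m-semiflow $G$. Assume moreover: (N1) there is a sequence of sets of functions $\mathcal{K}_N\subset C(\mathbb{R}^+,X)$, $N\ge 1$, each satisfying (K1)–(K4), such that, denoting by $G_N:\mathbb{R}^+\times X\to\mathcal{P}(X)$ the strict m-semiflow associated with $\mathcal{K}_N$, $$G(t,y)\subset G_N(t,y)\quad\text{for all } t\ge 0,\ N\ge 1,\ y\in X,$$ and there are constants $c_N$ with $$\mathrm{dist}_H\big(G_N(t,y_1),G_N(t,y_2)\big)\le e^{c_N t}\rho(y_1,y_2)\quad\text{for all } y_1,y_2\in X,\ t\ge 0,\ N\ge 1;$$ (N2) if $y_N\in\mathcal{K}_N$ and $y_N(0)\to y_0$ in $X$, then, up to a subsequence, $y_N\to y$ in $C([0,T];X)$ for every $T>0$, where $y\in\mathcal{K}$ and $y(0)=y_0$. If $\varphi\in\mathcal{K}$ is such that the closure of its positive orbit $\gamma^+(\varphi)=\bigcup_{t\ge 0}\{\varphi(t)\}$ is compact, then the set $\omega(\varphi)$ is chain recurrent with respect to $G$.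
   Context: $\mathbb{R}^+=[0,\infty)$; $\mathcal{P}(X)$ is the set of all non-empty subsets of $X$; $\mathrm{dist}(A,B)=\sup_{a\in A}\inf_{b\in B}\rho(a,b)$ and $\mathrm{dist}_H(A,B)=\max\{\mathrm{dist}(A,B),\mathrm{dist}(B,A)\}$. Conditions on a set $\mathcal{K}\subset C(\mathbb{R}^+,X)$: (K1) for every $x\in X$ there is $\varphi\in\mathcal{K}$ with $\varphi(0)=x$; (K2) if $\varphi\in\mathcal{K}$ and $\tau\ge 0$, then $\varphi(\cdot+\tau)\in\mathcal{K}$; (K3) if $\varphi_1,\varphi_2\in\mathcal{K}$ and $\varphi_2(0)=\varphi_1(s)$ with $s>0$, then the function equal to $\varphi_1(t)$ for $t\le s$ and to $\varphi_2(t-s)$ for $t>s$ belongs to $\mathcal{K}$; (K4) if $\varphi_n\in\mathcal{K}$ and $\varphi_n(0)\to x_0\in X$, then there are a subsequence and $\varphi_0\in\mathcal{K}$ with $\varphi_{n_k}(t)\to\varphi_0(t)$ uniformly on compact subsets of $[0,\infty)$. An m-semiflow is a map $G:\mathbb{R}^+\times X\to\mathcal{P}(X)$ with $G(0,x)=\{x\}$ and $G(t+s,x)\subset G(t,G(s,x))$ for all $t,s\ge0$, $x\in X$; it is strict if equality holds in the latter. Here $G(t,A)=\bigcup_{a\in A}G(t,a)$. The map associated with $\mathcal{K}$ is $G(t,x)=\{\varphi(t):\varphi\in\mathcal{K},\ \varphi(0)=x\}$; under (K1)–(K3) it is a strict m-semiflow. A map $\phi:\mathbb{R}\to X$ is a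 complete trajectory of $\mathcal{K}$ if $\phi(\cdot+h)|_{[0,\infty)}\in\mathcal{K}$ for all $h\in\mathbb{R}$. A set $A\subset X$ is quasi-invariant if for each $x\in A$ there is a complete trajectory $\phi$ of $\mathcal{K}$ with $\phi(0)=x$ and $\phi(t)\in A$ for all $t\in\mathbb{R}$. $\omega(\varphi)=\{y\in X:\exists\, t_n\to+\infty \text{ with }\varphi(t_n)\to y\}$. When $\gamma^+(\varphi)$ has compact closure, $\omega(\varphi)$ is non-empty, compact, connected and quasi-invariant. Chain recurrence: let $B\subset X$ be quasi-invariant. For $\varepsilon>0$, $t>0$ and $y,z\in B$, an $(\varepsilon,t)$-chain from $y$ to $z$ consists of finite sequences $\{y=y_1,y_2,\dots,y_{n+1}=z\}\subset B$ and $\{t_1,\dots,t_n\}\subset[t,+\infty)$ with $\mathrm{dist}(y_{i+1},G(t_i,y_i))<\varepsilon$ for $i=1,\dots,n$. A point $y\in B$ is chain recurrent if for all $\varepsilon>0$, $t>0$ there is an $(\varepsilon,t)$-chain from $y$ to $y$; $B$ is chain recurrent with respect to $G$ if each of its points is. *)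

(* Defs.v *)
From HB Require Import structures.
From mathcomp Require Import all_boot all_order all_algebra.
From mathcomp Require Import all_classical all_reals all_analysis.

Set Implicit Arguments.
Unset Strict Implicit.
Unset Printing Implicit Defensive.

Import Order.TTheory GRing.Theory Num.Theory.
Import numFieldTopology.Exports numFieldNormedType.Exports.

Local Open Scope classical_set_scope.
Local Open Scope ring_scope.

#[short(type="completeMetricType")]
HB.structure Definition CompleteMetric (K : numDomainType) :=
  { M of Metric K M & Complete M }.

(* Used as a type, [Rplus R] is the subtype of [R] with the induced topology,
   so that [Rplus R -> X] consists of functions defined on [0, +oo) only. *)
Definition Rplus (R : realType) : set R := [set x | 0 <= x].
Arguments Rplus : clear implicits.

Lemma nng_subproof (R : realType) (x : R) : Num.max 0 x \in Rplus R.
Proof. by rewrite inE /Rplus /= le_max lexx. Qed.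

(* [nng x] is [x] itself when [0 <= x]; it is only applied to such [x]. *)
Definition nng (R : realType) (x : R) : Rplus R :=
  exist _ (Num.max 0 x) (nng_subproof x).

Lemma val_nng (R : realType) (x : R) : 0 <= x -> \val (nng x) = x.
Proof. by move=> x0; exact/max_idPr. Qed.

Section Distances.
Context {R : realType} {X : metricType R}.

Definition hsemidist (A B : set X) : \bar R :=
  ereal_sup [set ereal_inf [set (mdist a b)%:E | b in B] | a in A].

Definition hausdorff_dist (A B : set X) : \bar R :=
  Order.max (hsemidist A B) (hsemidist B A).

End Distances.

Section Trajectories.
Context {R : realType} {X : metricType R}.
Implicit Types (K : set (Rplus R -> X)) (phi : Rplus R -> X) (B : set X).

Definition translate phi (tau : Rplus R) : Rplus R -> X :=
  fun t => phi (nng (\val t + \val tau)).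

Definition concat phi1 phi2 (s : Rplus R) : Rplus R -> X :=
  fun t => if \val t <= \val s then phi1 t else phi2 (nng (\val t - \val s)).

Definition condK1 K := forall x : X, exists2 phi, K phi & phi (nng 0) = x.

Definition condK2 K := forall phi tau, K phi -> K (translate phi tau).

Definition condK3 K := forall phi1 phi2 (s : Rplus R),
  K phi1 -> K phi2 -> 0 < \val s -> phi2 (nng 0) = phi1 s ->
  K (concat phi1 phi2 s).

Definition condK4 K := forall (phi_ : nat -> Rplus R -> X) (x0 : X),
  (forall n, K (phi_ n)) -> phi_ n (nng 0) @[n --> \oo] --> x0 ->
  exists k : nat -> nat, exists phi0, [/\ increasing_seq k, K phi0 &
    {family compact, (fun n => phi_ (k n)) @ \oo --> phi0}].

Definition trajectory_family K :=
  [/\ forall phi, K phi -> continuous phi,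
      condK1 K, condK2 K, condK3 K & condK4 K].

Definition semiflow K (t : Rplus R) (x : X) : set X :=
  [set phi t | phi in [set phi | K phi /\ phi (nng 0) = x]].

Definition complete_trajectory K (psi : R -> X) :=
  forall h : R, K (fun t : Rplus R => psi (\val t + h)).

Definition quasi_invariant K B := forall x, B x ->
  exists psi : R -> X,
    [/\ complete_trajectory K psi, psi 0 = x & forall t, B (psi t)].

Definition positive_orbit phi : set X := range phi.

Definition omega_limit phi : set X :=
  [set y | exists t : nat -> Rplus R,
     (\val (t n) : R) @[n --> \oo] --> +oo /\
     phi (t n) @[n --> \oo] --> y].

(* The points are indexed from 0 to [n] and the times from 0 to [n - 1]; values
   of [ys] and [ts] at larger indices are irrelevant. A chain has at least one
   step. *)
Definition chain K B (eps : R) (t : Rplus R) (y z : X) :=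
  exists (n : nat) (ys : nat -> X) (ts : nat -> Rplus R),
    [/\ (0 < n)%N, ys 0%N = y, ys n = z,
        forall i, (i <= n)%N -> B (ys i) &
        forall i, (i < n)%N -> \val t <= \val (ts i) /\
          (hsemidist [set ys i.+1] (semiflow K (ts i) (ys i)) < eps%:E)%E].

Definition chain_recurrent_point K B (y : X) :=
  forall (eps : R) (t : Rplus R), 0 < eps -> 0 < \val t -> chain K B eps t y y.

(* Chain recurrence is a notion about quasi-invariant sets, hence the first
   conjunct. *)
Definition chain_recurrent K B :=
  quasi_invariant K B /\ forall y, B y -> chain_recurrent_point K B y.

End Trajectories.

(* Main.v *)
(* (K4) makes G upper semicontinuous, uniformly for bounded times: each b in
   omega(phi) has a radius d(b) such that G(t, x) stays close to G(t, b) when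
   rho(b, x) < d(b). By compactness the orbit eventually stays in the balls
   B(b, d(b)), b in omega(phi). Cut the orbit, between two late visits near y,
   into pieces of equal length tau in [t, 2t]: the centres of balls containing
   the cutting points form a chain from y to y. *)
Require Import Defs.
From mathcomp Require Import all_boot all_order all_algebra.
From mathcomp Require Import all_classical all_reals all_analysis.

Set Implicit Arguments.
Unset Strict Implicit.
Unset Printing Implicit Defensive.

Import Order.TTheory GRing.Theory Num.Theory.
Import numFieldTopology.Exports numFieldNormedType.Exports.

Local Open Scope classical_set_scope.
Local Open Scope ring_scope.


(** * The half-line as a subtype of the reals *)

Section HalfLine.
Context {R : realType}.

Lemma nngK (s : Rplus R) : nng (\val s) = s.
Proof. by apply: val_inj; rewrite val_nng//; have := valP s; rewrite inE. Qed.

Lemma Rplus_ge0 (s : Rplus R) : 0 <= \val s :> R.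
Proof. by have := valP s; rewrite inE. Qed.

Lemma nng_continuous : continuous (@nng R).
Proof.
apply/continuous_comp_initial => x.
by apply: continuous_max; [exact: cvg_cst|exact: cvg_id].
Qed.

(** This lets locally uniform convergence from (K4) be read as uniform convergence on [0, T]. *)
Lemma Rplus_segment_compact (T : R) : compact [set t : Rplus R | \val t <= T].
Proof.
suff -> : [set t : Rplus R | \val t <= T] = @nng R @` `[0, T]%classic.
  apply: (@continuous_compact _ (Rplus R)); last exact: segment_compact.
  by apply: continuous_subspaceT; exact: nng_continuous.
apply/seteqP; split=> [t /= tT|_ /= [r + <-]].
  by exists (\val t); [rewrite in_itv/= Rplus_ge0|rewrite nngK].
by rewrite in_itv/= => /andP[r0 rT]; rewrite ge_max (le_trans r0).
Qed.

End HalfLine.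

(** * Limits and semidistances in terms of [mdist] *)

Section MetricLimits.
Context {R : realType} {X : metricType R}.

Lemma cvg_mdistP (u : nat -> X) (x : X) :
  u n @[n --> \oo] --> x <->
  forall e, 0 < e -> \forall n \near \oo, mdist x (u n) < e.
Proof.
split=> [/cvg_ball ux e /ux|ux]; first by rewrite ballEmdist.
by apply/cvg_ballP => e /ux; rewrite ballEmdist.
Qed.

Lemma cvg_mdist_natinv (u : nat -> X) (x : X) :
  (forall n, mdist x (u n) < n.+1%:R^-1) -> u n @[n --> \oo] --> x.
Proof.
move=> ux; apply/cvg_mdistP => e e0; near=> n.
rewrite (lt_trans (ux n))//; near: n; exact: near_infty_natSinv_lt (PosNum e0).
Unshelve. all: by end_near.
Qed.

Lemma hsemidist1_lt (x : X) (B : set X) (e : R) :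
  (hsemidist [set x] B < e%:E)%E <-> exists2 b, B b & mdist x b < e.
Proof.
rewrite /hsemidist image_set1 ereal_sup1; split.
  by move=> /ereal_inf_lt[_ [b Bb <-]]; rewrite lte_fin; exists b.
move=> [b Bb xb]; apply: (@le_lt_trans _ _ (mdist x b)%:E); last by rewrite lte_fin.
by apply: ge_ereal_inf; exists (mdist x b)%:E => //; exists b.
Qed.

Lemma uniform_cvg_mdist {T : choiceType} (A : set T) (f : nat -> T -> X)
    (g : T -> X) (e : R) :
  0 < e -> {uniform A, f @ \oo --> g} ->
  \forall n \near \oo, forall t, A t -> mdist (g t) (f n t) < e.
Proof.
move=> e0 fg.
have /fg : nbhs (g : {uniform` A -> X})
    [set h | forall t, A t -> mdist (g t) (h t) < e].
  apply/uniform_nbhs; exists [set xy | ball xy.1 e xy.2].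
  split; first exact: (entourage_ball _ (PosNum e0)).
  by move=> h /= hE t /hE; rewrite ballEmdist.
by [].
Qed.

End MetricLimits.

Lemma increasing_seq_ge (k : nat -> nat) :
  increasing_seq k -> forall n, (n <= k n)%N.
Proof.
move=> kinc; elim=> // n /leq_ltn_trans; apply.
by rewrite (leqW_mono kinc).
Qed.

(** * Omega-limit sets and their quasi-invariance *)

Section OmegaLimit.
Context {R : realType} {X : metricType R}.
Implicit Types (K : set (Rplus R -> X)) (phi : Rplus R -> X).

Lemma omega_limitP phi (y : X) :
  omega_limit phi y <->
  forall (e M : R), 0 < e -> exists2 s, M <= \val s & mdist y (phi s) < e.
Proof.
split=> [[t [/cvgryPge tinf /cvg_mdistP ty]] e M e0|H].
  have [n _ /(_ n (leqnn n))[nM ne]] := filterI (tinf M) (ty e e0).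
  by exists (t n).
have /choice[s sP] : forall n : nat, exists s,
    n%:R <= \val s :> R /\ mdist y (phi s) < n.+1%:R^-1.
  by move=> n; have [|s sn ys] := H n.+1%:R^-1 n%:R; [|exists s].
exists s; split.
  apply/cvgryPge => M; near=> n.
  rewrite (le_trans _ (sP n).1)//; near: n; exact: nbhs_infty_ger.
by apply: cvg_mdist_natinv => n; exact: (sP n).2.
Unshelve. all: by end_near.
Qed.

(** Compactness gives a cluster point p of the sequence phi(s n); since s n >= n, the visits of phi
    near p occur at arbitrarily late times. *)
Lemma orbit_cluster phi (s : nat -> Rplus R) :
  compact (closure (positive_orbit phi)) ->
  (forall n, n%:R <= \val (s n)) ->
  exists2 p, omega_limit phi p &
    forall e N, 0 < e -> exists2 n, (N <= n)%N & mdist p (phi (s n)) < e.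
Proof.
move=> /(_ (phi (s n) @[n --> \oo])) cpt sn.
have [|p [_ pcl]] := cpt.
  by apply: (@filterE _ \oo) => n; apply: subset_closure; exists (s n).
have pP e N : 0 < e -> exists2 n, (N <= n)%N & mdist p (phi (s n)) < e.
  move=> e0.
  have [||_ [[n Nn <-] pn]] := pcl ((phi \o s) @` [set n | (N <= n)%N]) (ball p e).
  - by exists N => // n Nn; exists n.
  - exact: nbhsx_ballx.
  by exists n => //; rewrite ballEmdist in pn.
exists p => //; apply/omega_limitP => e M e0.
have [n Mn pn] := pP e (Num.bound `|M|) e0; exists (s n) => //.
rewrite (le_trans _ (sn n))// (le_trans (ler_norm M))//.
by rewrite (le_trans (ltW (archi_boundP _)))// ler_nat.
Qed.

(** Gives x one unit of past inside omega(phi). Take late times s_n with phi(s_n) -> x and start phi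
    one unit earlier: (K4) yields a limit of these translates, which is at x at time 1. *)
Lemma omega_backward K phi (x : X) :
  condK2 K -> condK4 K -> K phi -> compact (closure (positive_orbit phi)) ->
  omega_limit phi x ->
  exists psi, [/\ K psi, psi (nng 1) = x & forall t, omega_limit phi (psi t)].
Proof.
move=> K2 K4 Kphi cpt /omega_limitP xP.
have /choice[s sP] : forall n : nat, exists s : Rplus R,
    n%:R + 1 <= \val s /\ mdist x (phi s) < n.+1%:R^-1.
  by move=> n; have [|s sn xs] := xP n.+1%:R^-1 (n%:R + 1); [|exists s].
pose r n := nng (\val (s n) - 1).
have rE n : \val (r n) = \val (s n) - 1.
  by rewrite val_nng// subr_ge0 (le_trans _ (sP n).1)// lerDr.
have r_ge n : n%:R <= \val (r n) by rewrite rE lerBrDr (sP n).1.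
(* (K4) needs convergent initial points, so indices [k n] are chosen along which phi(r) tends to a
   cluster point. [k] need not be monotone; n <= k n suffices. *)
have [p _ pP] := orbit_cluster cpt r_ge.
have /choice[k kP] : forall n, exists k,
    (n <= k)%N /\ mdist p (phi (r k)) < n.+1%:R^-1.
  by move=> n; have [|k nk pk] := pP n.+1%:R^-1 n; [|exists k].
have [||l [psi [linc Kpsi]]] := K4 (fun n => translate phi (r (k n))) p.
- by move=> n; exact: K2.
- apply: cvg_mdist_natinv => n.
  by rewrite /translate val_nng// add0r nngK; exact: (kP n).2.
move=> /pointwise_cvg_compact_family /pointwise_cvgP psiP.
have kl_ge n : (n <= k (l n))%N.
  exact: leq_trans (increasing_seq_ge linc n) (kP _).1.
exists psi; split => //.
  apply: (cvg_unique (@metric_hausdorff _ X) (psiP (nng 1))).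
  apply: cvg_mdist_natinv => n /=.
  rewrite /translate rE val_nng// subrKC nngK (lt_le_trans (sP _).2)//.
  by rewrite lef_pV2 ?posrE// ler_nat ltnS.
move=> t; apply/omega_limitP => e M e0.
have /cvg_mdistP /(_ _ e0)[n0 _ n0P] := psiP t.
(* Beyond [n0] the translate is e-close to psi t; beyond the bound of |M| the time is at least M. *)
pose n := maxn n0 (Num.bound `|M|).
exists (nng (\val t + \val (r (k (l n))))); last exact: n0P (leq_maxl _ _).
rewrite val_nng ?addr_ge0 ?Rplus_ge0//.
rewrite (le_trans (ler_norm M))// (le_trans (ltW (archi_boundP _)))//.
rewrite (@le_trans _ _ (k (l n))%:R)//.
  by rewrite ler_nat (leq_trans _ (kl_ge n))// leq_maxr.
by rewrite (le_trans (r_ge _))// lerDr Rplus_ge0.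
Qed.

Lemma omega_limit_quasi_invariant K phi :
  condK2 K -> condK3 K -> condK4 K -> K phi ->
  compact (closure (positive_orbit phi)) ->
  quasi_invariant K (omega_limit phi).
Proof.
move=> K2 K3 K4 Kphi cpt x wx.
pose P psi := K psi /\ forall t, omega_limit phi (psi t).
(* [f] prepends one unit of past to a trajectory lying in omega(phi), gluing by (K3). Outside [P]
   its value is irrelevant. *)
have /choice[f fP] : forall psi, exists psi', P psi ->
    P psi' /\ forall t : Rplus R, psi' (nng (\val t + 1)) = psi t.
  move=> psi; have [[Kpsi wpsi]|nP] := pselect (P psi); last by exists psi.
  have [psi1 [Kpsi1 psi1E wpsi1]] :=
    omega_backward K2 K4 Kphi cpt (wpsi (nng 0)).
  exists (concat psi1 psi (nng 1)) => _; split.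
    split=> [|t]; last by rewrite /concat; case: ifP.
    by apply: K3 => //; rewrite val_nng.
  move=> t; rewrite /concat !val_nng ?addr_ge0 ?Rplus_ge0//.
  (* At the junction t = 0, [concat] still takes the first branch, so psi1(1) = psi(0) is needed. *)
  rewrite gerDr addrK nngK; case: ifPn => // t0.
  have {}t0 : \val t = 0 by apply/eqP; rewrite eq_le t0 Rplus_ge0.
  by rewrite t0 add0r psi1E -t0 nngK.
have [psi0 [Kpsi0 psi0x wpsi0]] := omega_backward K2 K4 Kphi cpt wx.
(* [Psi n] lives in omega(phi) and reaches x at time n; the
   maps [Psi n (. + n)] agree and glue to a complete trajectory. *)
pose Psi n := iter n f (translate psi0 (nng 1)).
have PsiP n : P (Psi n).
  elim: n => [|n /fP[]//]; split; first exact: K2.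
  by move=> t; exact: wpsi0.
have PsiD m j (t : Rplus R) : Psi (m + j)%N (nng (\val t + j%:R)) = Psi m t.
  elim: j => [|j <-]; first by rewrite addn0 addr0 nngK.
  rewrite addnS -[RHS](fP _ (PsiP _)).2 val_nng ?addr_ge0 ?Rplus_ge0//.
  by rewrite -addrA natr1.
pose b (r : R) := Num.bound `|r|.
have b_ge (r : R) : 0 <= r + (b r)%:R.
  rewrite addrC -lerBlDr sub0r (le_trans (ler_norm _))// normrN.
  exact/ltW/archi_boundP.
pose psi r := Psi (b r) (nng (r + (b r)%:R)).
(* The levels m and [b r] are compared at the common level m + b r, through [PsiD]. *)
have psiE r m : 0 <= r + m%:R -> psi r = Psi m (nng (r + m%:R)).
  move=> rm; rewrite /psi -(PsiD _ m) -[RHS](PsiD _ (b r)) addnC !val_nng//.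
  by rewrite addrAC.
exists psi; split.
(* The level [b h] serves every time t + h with t >= 0, so (K2) applies to a single [Psi]. *)
- move=> h; rewrite (_ : (fun _ => _) = translate (Psi (b h)) (nng (h + (b h)%:R))).
    by apply: K2; exact: (PsiP _).1.
  apply/funext => t; rewrite /translate val_nng// addrA; apply: psiE.
  by rewrite -addrA addr_ge0 ?Rplus_ge0.
- by rewrite (psiE 0 0%N) ?addr0// /Psi/= /translate !val_nng// add0r.
- by move=> t; exact: (PsiP _).2.
Qed.

End OmegaLimit.

(** * Chains along the orbit *)

Section ChainRecurrence.
Context {R : realType} {X : metricType R}.
Implicit Types (K : set (Rplus R -> X)) (phi : Rplus R -> X).

(** Otherwise there are trajectories with initial points tending to b, each staying e-far from
    G(t_n, b) at some time t_n <= T. Their (K4) limit psi starts at b, and uniform convergence on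
    [0, T] copes with the varying t_n. *)
Lemma semiflow_upper_semicontinuous K (b : X) (T e : R) : condK4 K -> 0 < e ->
  exists2 d, 0 < d & forall x (t : Rplus R) z, mdist b x < d -> \val t <= T ->
    semiflow K t x z -> exists2 w, semiflow K t b w & mdist z w < e.
Proof.
move=> K4 e0; apply: contrapT => nusc.
have /choice[f fP] : forall n : nat, exists f : (Rplus R -> X) * Rplus R,
    [/\ K f.1, mdist b (f.1 (nng 0)) < n.+1%:R^-1, \val f.2 <= T &
      forall w, semiflow K f.2 b w -> ~ mdist (f.1 f.2) w < e].
  move=> n; apply: contrapT => nf; apply: nusc; exists n.+1%:R^-1 => //.
  move=> x t z bx tT [psi [Kpsi psi0] psiz]; apply: contrapT => nw; apply: nf.
  exists (psi, t); split => //=; first by rewrite psi0.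
  by move=> w bw; rewrite psiz => zw; apply: nw; exists w.
have [||k [psi [kinc Kpsi]]] := K4 (fun n => (f n).1) b.
- by move=> n; case: (fP n).
- by apply: cvg_mdist_natinv => n; case: (fP n).
move=> Kcv.
have psicv : {uniform [set t : Rplus R | \val t <= T],
    (fun n => (f (k n)).1) @ \oo --> psi}.
  by move/fam_cvgP: Kcv; apply; exact: Rplus_segment_compact.
have [n _ /(_ n (leqnn n))/= psin] := uniform_cvg_mdist e0 psicv.
(* The contradicting point of G(t_n, b) is psi(t_n), at the same time t_n; it remains to see that
   psi(0) = b. *)
have [_ _ tT /(_ (psi (f (k n)).2))] := fP (k n).
apply; last by rewrite metric_sym psin.
exists psi => //; split => //.
have /pointwise_cvg_compact_family /pointwise_cvgP /(_ (nng 0)) psi0 := Kcv.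
apply: (cvg_unique (@metric_hausdorff _ X) psi0).
apply: cvg_mdist_natinv => m; have [_ /lt_le_trans + _ _] := fP (k m); apply.
by rewrite lef_pV2 ?posrE// ler_nat ltnS increasing_seq_ge.
Qed.

(** Late times at which phi avoids all the balls would have a cluster point p in omega(phi), and phi
    would then enter the ball of p. *)
Lemma orbit_eventually_near_omega phi (d : X -> R) :
  compact (closure (positive_orbit phi)) -> (forall b, 0 < d b) ->
  exists M : R, forall s, M <= \val s ->
    exists2 b, omega_limit phi b & mdist b (phi s) < d b.
Proof.
move=> cpt d0; apply: contrapT => nM.
have /choice[s sP] : forall n : nat, exists s : Rplus R, n%:R <= \val s /\
    forall b, omega_limit phi b -> ~ mdist b (phi s) < d b.
  move=> n; apply: contrapT => ns; apply: nM; exists n%:R => s ns'.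
  apply: contrapT => nb; apply: ns; exists s; split => // b wb bs.
  by apply: nb; exists b.
have [p wp /(_ (d p) 0%N (d0 p))[n _ pn]] :=
  orbit_cluster cpt (fun n => (sP n).1).
exact: (sP n).2 wp pn.
Qed.

Lemma omega_limit_chain_recurrent_point K phi (y : X) :
  condK2 K -> condK4 K -> K phi -> compact (closure (positive_orbit phi)) ->
  omega_limit phi y -> chain_recurrent_point K (omega_limit phi) y.
Proof.
move=> K2 K4 Kphi cpt wy eps t eps0 t0.
have e0 : 0 < eps / 2 by rewrite divr_gt0.
(* The step length [tau] is fixed only after these radii, so they must serve all times up to 2t. *)
have /choice[d dP] : forall b, exists d, 0 < d /\ forall x (s : Rplus R) z,
    mdist b x < d -> \val s <= \val t *+ 2 -> semiflow K s x z ->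
    exists2 w, semiflow K s b w & mdist z w < eps / 2.
  move=> b.
  have [d d0 dP] := semiflow_upper_semicontinuous b (\val t *+ 2) K4 e0.
  by exists d.
(* [d b] controls the step that leaves b; eps / 2 bounds the error on arriving at b. *)
pose d' b := Num.min (d b) (eps / 2).
have d'0 b : 0 < d' b by rewrite lt_min (dP b).1.
have [M MP] := orbit_eventually_near_omega cpt d'0.
have /omega_limitP yP := wy.
have [s0 Ms0 ys0] := yP (d' y) M (d'0 y).
have [s1 s01 ys1] := yP (d' y) (\val s0 + \val t) (d'0 y).
(* The largest number of pieces of length at least t. Since s1 >= s0 + t, n >= 1, and n + 1 <= 2n
   then gives tau <= 2t. *)
pose n := Num.truncn ((\val s1 - \val s0) / \val t).
have /andP[nle ltn] : n%:R <= (\val s1 - \val s0) / \val t < n.+1%:R.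
  apply: truncn_itv; rewrite divr_ge0 ?Rplus_ge0// subr_ge0.
  by rewrite (le_trans _ s01)// lerDl Rplus_ge0.
have n0 : (0 < n)%N.
  by rewrite truncn_gt0 ler_pdivlMr// mul1r lerBrDl.
have n0R : 0 < n%:R :> R by rewrite ltr0n.
pose tau : R := (\val s1 - \val s0) / n%:R.
have t_tau : \val t <= tau.
  by rewrite ler_pdivlMr// mulrC -ler_pdivlMr.
have tau_2t : tau <= \val t *+ 2.
  rewrite ler_pdivrMr// mulrnAl -mulrnAr -mulrnA -ler_pdivrMl// mulrC.
  by rewrite (le_trans (ltW ltn))// ler_nat muln2 -addnn -add1n leq_add2r.
have tau0 : 0 <= tau by rewrite (le_trans (ltW t0)).
pose r i := nng (\val s0 + i%:R * tau).
have rE i : \val (r i) = \val s0 + i%:R * tau.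
  by rewrite val_nng// addr_ge0 ?Rplus_ge0// mulr_ge0.
have r0E : r 0%N = s0 by rewrite /r mul0r addr0 nngK.
have rnE : r n = s1 by rewrite /r mulrC divfK ?gt_eqF// subrKC nngK.
(* At both ends the centre is forced to be y, which is allowed as phi(s0) and phi(s1) lie within d'
   y of y. *)
have /choice[c cP] : forall i, exists b, [/\ omega_limit phi b,
    mdist b (phi (r i)) < d' b & i = 0%N \/ i = n -> b = y].
  move=> i; have [i0n|i0n] := pselect (i = 0%N \/ i = n).
    by exists y; split => //; case: i0n => ->; rewrite ?r0E ?rnE.
  have [|b wb bi] := MP (r i); last by exists b.
  by rewrite rE (le_trans Ms0)// lerDl mulr_ge0.
exists n, c, (fun=> nng tau); split => //.
- by have [_ _ ->] := cP 0%N; [|left].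
- by have [_ _ ->] := cP n; [|right].
- by move=> i _; have [] := cP i.
move=> i _; rewrite val_nng//; split => //; apply/hsemidist1_lt.
have step : semiflow K (nng tau) (phi (r i)) (phi (r i.+1)).
  exists (translate phi (r i)).
    by split; [exact: K2|rewrite /translate val_nng// add0r nngK].
  rewrite /translate; congr (phi (nng _)).
  by rewrite rE val_nng// addrC -addrA -natr1 mulrDl mul1r.
(* Some w in G(tau, c i) is within eps / 2 of phi(r (i + 1)), which is within eps / 2 of c (i +
   1). *)
have [_ + _] := cP i; rewrite lt_min => /andP[ci _].
have [|w Gw zw] := (dP (c i)).2 _ _ _ ci _ step; first by rewrite val_nng.
exists w => //; have [_ + _] := cP i.+1; rewrite lt_min => /andP[_ ci1].
by rewrite (splitr eps) (le_lt_trans (metric_triangle _ (phi (r i.+1)) _))// ltrD.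
Qed.

End ChainRecurrence.

Theorem theorem5 (R : realType) (X : completeMetricType R)
  (K : set (Rplus R -> X)) (HK : trajectory_family K)
  (KN : nat -> set (Rplus R -> X)) (c : nat -> R)
  (HKN : forall N, (1 <= N)%N -> trajectory_family (KN N))
  (N1_incl : forall (t : Rplus R) (N : nat) (y : X), (1 <= N)%N ->
    semiflow K t y `<=` semiflow (KN N) t y)
  (N1_lip : forall (y1 y2 : X) (t : Rplus R) (N : nat), (1 <= N)%N ->
    (hausdorff_dist (semiflow (KN N) t y1) (semiflow (KN N) t y2)
       <= (expR (c N * \val t) * mdist y1 y2)%:E)%E)
  (N2 : forall (y_ : nat -> Rplus R -> X) (y0 : X),
    (forall N, (1 <= N)%N -> KN N (y_ N)) ->
    y_ N (nng 0) @[N --> \oo] --> y0 ->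
    exists (k : nat -> nat) (y : Rplus R -> X),
      [/\ increasing_seq k, K y, y (nng 0) = y0 &
        forall T : R, 0 < T ->
          {uniform [set t : Rplus R | \val t <= T],
             (fun n => y_ (k n)) @ \oo --> y}])
  (phi : Rplus R -> X) (Hphi : K phi)
  (Hcpt : compact (closure (positive_orbit phi))) :
  chain_recurrent K (omega_limit phi).
Proof.
case: HK => _ K1 K2 K3 K4; split; first exact: omega_limit_quasi_invariant.
by move=> y wy; exact: omega_limit_chain_recurrent_point.
Qed.
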